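(* Let $a\in\mathbb{R}$, let $\phi:[a,\infty)\to\mathbb{R}$ be a strictly increasing $C^1$ function with $\phi'>0$ everywhere and $\phi(x)\to\infty$ as $x\to\infty$, and let $w$ be a weight function on $[a,\infty)$. Then the $w$-weighted Laplace transform with respect to $\phi$ can be written as the composition $$\mathcal{L}_{\phi;w(x)}=\mathcal{L}\circ Q_{\phi(x)-\phi(a)}^{-1}\circ M_{w(x)},$$ where $\mathcal{L}$ is the usual Laplace transform.
   Context: For $f:[a,\infty)\to\mathbb{C}$, the $w$-weighted Laplace transform with respect to $\phi$ is $$\mathcal{L}_{\phi;w(x)}\{f(x)\}=F(s)=\int_a^\infty e^{-s[\phi(x)-\phi(a)]}w(x)f(x)\phi'(x)\,dx$$ for all $s\in\mathbb{C}$ such that the integral converges. The usual Laplace transform is $\mathcal{L}\{g\}(s)=\int_0^\infty e^{-sx}g(x)\,dx$. $M_{w(x)}$ is the multiplication operator $(M_{w(x)}f)(x)=w(x)f(x)$. For a strictly increasing function $\psi$, $Q_\psi g=g\circ\psi$ for any $g$ defined on the range of $\psi$, and $Q_\psi^{-1}h=h\circ\psi^{-1}$; here $\psi(x)=\phi(x)-\phi(a)$, mapping $[a,\infty)$ onto $[0,\infty)$. *)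

(* Defs.v *)
From mathcomp Require Export all_boot all_order all_algebra complex.
From mathcomp Require Export all_classical all_reals all_analysis.
Export Order.TTheory GRing.Theory Num.Theory.
Export numFieldNormedType.Exports.

Set Implicit Arguments.
Unset Strict Implicit.
Unset Printing Implicit Defensive.

Local Open Scope classical_set_scope.
Local Open Scope ring_scope.
Local Open Scope complex_scope.

(* Going through [numFieldType] is what gives the complex numbers the topology
   induced by the modulus; [R[i]] alone has no canonical one. *)
Definition Cplx (R : realType) : numFieldType := R[i].

(* [complex.Re] and [complex.Im] are valued in R, unlike ['Re] and ['Im]. *)
Definition cexp (R : realType) (z : Cplx R) : Cplx R :=
  (expR (complex.Re z) * cos (complex.Im z)) +i*
  (expR (complex.Re z) * sin (complex.Im z)).

(* [lebesgue_measure] only knows Borel sets; its completion is used so that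
   functions need only be Lebesgue measurable. *)
Definition cintegrable (R : realType) (D : set R) (g : R -> Cplx R) : Prop :=
  (@completed_lebesgue_measure R).-integrable D
    (EFin \o (fun x => complex.Re (g x))) /\
  (@completed_lebesgue_measure R).-integrable D
    (EFin \o (fun x => complex.Im (g x))).

Definition cintegral (R : realType) (D : set R) (g : R -> Cplx R) : Cplx R :=
  (\int[@completed_lebesgue_measure R]_(x in D) complex.Re (g x)) +i*
  (\int[@completed_lebesgue_measure R]_(x in D) complex.Im (g x)).

(* Convergence of an integral over [a, +oo): g is Lebesgue integrable on every
   [a, b] and the integrals over [a, b] have a limit as b tends to +oo.
   This allows integrals that do not converge absolutely at infinity. *)
Definition integral_converges (R : realType) (a : R) (g : R -> Cplx R) : Prop :=
  (forall b, a <= b -> cintegrable `[a, b] g) /\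
  cvg (cintegral `[a, b] g @[b --> +oo]).

(* [None] stands for a divergent integral. *)
Definition improper_integral (R : realType) (a : R) (g : R -> Cplx R) :
    option (Cplx R) :=
  if `[< integral_converges a g >]
  then Some (lim (cintegral `[a, b] g @[b --> +oo]))
  else None.

(* Derivative relative to D, hence one-sided at an endpoint of an interval D;
   the values of phi outside D are irrelevant. *)
Definition slope_on (R : realType) (D : set R) (phi : R -> R) (x : R) :
    set_system R :=
  ((phi y - phi x) / (y - x)) @[y --> within D x^'].

Definition derive_on (R : realType) (D : set R) (phi : R -> R) (x : R) : R :=
  lim (slope_on D phi x).

Definition C1_on (R : realType) (D : set R) (phi : R -> R) : Prop :=
  (forall x, D x -> cvg (slope_on D phi x)) /\
  {within D, continuous (derive_on D phi)}.

(* A function on [a, +oo) is represented by a total function on R of which only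
   the values on [a, +oo) are used; a transform is a partial function of s,
   defined exactly where its integral converges. *)
Definition laplace (R : realType) (g : R -> Cplx R) : Cplx R -> option (Cplx R) :=
  fun s => improper_integral 0 (fun x => cexp (- s * x%:C) * g x).

Definition weighted_laplace (R : realType) (a : R) (phi : R -> R)
    (w f : R -> Cplx R) : Cplx R -> option (Cplx R) :=
  fun s => improper_integral a (fun x =>
    cexp (- s * (phi x - phi a)%:C) * w x * f x
      * (derive_on `[a, +oo[ phi x)%:C).

Definition mul_op (R : realType) (w f : R -> Cplx R) : R -> Cplx R :=
  fun x => w x * f x.

(* [pinv D psi] is the inverse of the restriction of psi to D. *)
Definition Qinv (R : realType) (D : set R) (psi : R -> R) (h : R -> Cplx R) :
    R -> Cplx R :=
  h \o pinv D psi.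

(* Main.v *)
(** Substituting [y = phi x - phi a] on each [[a, b]] turns the weighted
    transform into the usual one. As [w f] is only assumed Lebesgue measurable
    (relative to the completed measure), the substitution is proved measure
    theoretically: by the fundamental theorem of calculus, the image of the
    measure [F' dx] under a C^1 increasing bijection [F] of the line agrees with
    the Lebesgue measure on intervals, hence on Borel sets, and then on
    completed sets because [F] and its inverse preserve null sets. *)
From HB Require Import structures.
Require Import Defs.
From mathcomp Require Import measurable_realfun.

Set Implicit Arguments.
Unset Strict Implicit.
Unset Printing Implicit Defensive.

Local Open Scope classical_set_scope.
Local Open Scope ring_scope.

(** * Integration against a measure given as the image of a density *)

Section density_pushforward.
Local Open Scope ereal_scope.
Context d1 d2 (X : measurableType d1) (Y : measurableType d2) (R : realType).
Variables (mu : {measure set X -> \bar R}) (nu : {measure set Y -> \bar R}).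
Variables (F : X -> Y) (h : X -> R).
Hypotheses (mF : measurable_fun setT F) (mh : measurable_fun setT h).
Hypothesis h_ge0 : forall x, (0 <= h x)%R.
Hypothesis nuE : forall A, measurable A ->
  nu A = \int[mu]_(x in F @^-1` A) (h x)%:E.

Import HBNNSimple.

Let mpre A : measurable A -> measurable (F @^-1` A).
Proof. by move=> mA; rewrite -(setTI (_ @^-1` _)); exact: mF. Qed.

(** A simple function is a finite combination of indicators of its level sets, and on a single level
    set the claim is [nuE]. *)
Lemma ge0_integral_nnsfun_density_pushforward D (s : {nnsfun Y >-> R}) :
  measurable D ->
  \int[nu]_(y in D) (s y)%:E = \int[mu]_(x in F @^-1` D) (s (F x) * h x)%:E.
Proof.
move=> mD; have mFD := mpre mD.
under eq_integral do rewrite fimfunE -fsumEFin//.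
rewrite ge0_integral_fsum//; last 2 first.
- by move=> y; exact/measurable_EFinP/measurable_funM.
- by move=> y x _; rewrite nnfun_muleindic_ge0.
under [RHS]eq_integral.
  move=> x _; rewrite fimfunE EFinM -fsumEFin// ge0_mule_fsuml//; last first.
    by move=> r; rewrite nnfun_muleindic_ge0.
  over.
have mi r : measurable_fun setT (fun x => (\1_(s @^-1` [set r]) (F x) : R)).
  have m1 : measurable_fun setT (\1_(s @^-1` [set r]) : Y -> R).
    exact: measurable_indic.
  exact: measurableT_comp m1 mF.
rewrite [RHS]ge0_integral_fsum//; last 2 first.
- move=> r; apply: emeasurable_funM; apply/measurable_EFinP.
    by apply: measurable_funM => //; exact: measurable_funTS.
  exact: measurable_funTS.
- by move=> r x _; rewrite mule_ge0 ?nnfun_muleindic_ge0 ?lee_fin.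
apply: eq_fsbigr => r _.
rewrite integralZl_indic_nnsfun// integral_indic//= nuE; last exact: measurableI.
(* The scalar [r] can only be pulled out when nonnegative; a negative [r] is not a value of [s], so
   its level set is empty and both sides vanish. *)
have [r0|r0] := leP 0%R r; last first.
  rewrite preimage_nnfun0// set0I preimage_set0 integral_set0 mule0.
  by rewrite integral0_eq// => x _; rewrite indicE memNset// mulr0 mul0e.
under [RHS]eq_integral do rewrite EFinM -muleA.
rewrite ge0_integralZl//; last 2 first.
- apply: emeasurable_funM; first exact/measurable_EFinP/measurable_funTS.
  exact/measurable_EFinP/measurable_funTS.
- by move=> x _; rewrite mule_ge0 ?lee_fin.
congr (_ * _); rewrite preimage_setI integral_mkcondl.
apply: eq_integral => x _; rewrite patchE indicE.
rewrite -[F x \in _]/(x \in F @^-1` (s @^-1` [set r])).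
by case: ifPn => _; rewrite (mul1e, mul0e).
Qed.

(** Monotone convergence on both sides, along an increasing sequence of simple functions tending to
    [f]; multiplying by [h >= 0] keeps the sequence increasing. *)
Lemma ge0_integral_density_pushforward D (f : Y -> \bar R) :
  measurable D -> measurable_fun D f -> (forall y, D y -> 0 <= f y) ->
  \int[nu]_(y in D) f y = \int[mu]_(x in F @^-1` D) (f (F x) * (h x)%:E).
Proof.
move=> mD mf f0; have mFD := mpre mD.
pose f_ := nnsfun_approx mD mf.
have ndf x : {homo (fun n => f_ n x) : m n / (m <= n)%N >-> (m <= n)%R}.
  by move=> m n mn; exact/lefP/nd_nnsfun_approx.
transitivity (limn (fun n => \int[nu]_(x in D) (f_ n x)%:E)).
  rewrite -monotone_convergence//.
  - apply: eq_integral => y /[!inE] yD; apply/esym/cvg_lim => //.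
    exact: cvg_nnsfun_approx.
  - by move=> n; exact/measurable_EFinP/measurable_funTS.
  - by move=> n y _; rewrite lee_fin.
  - by move=> y _ m n mn; rewrite lee_fin ndf.
under eq_fun do rewrite ge0_integral_nnsfun_density_pushforward//.
rewrite -monotone_convergence//.
- apply: eq_integral => x /[!inE] Dx; apply/cvg_lim => //.
  under eq_fun do rewrite EFinM.
  by apply: cvgeZr => //; exact: cvg_nnsfun_approx.
- move=> n; apply/measurable_EFinP/measurable_funTS/measurable_funM => //.
  exact: measurableT_comp.
- by move=> n x _; rewrite lee_fin mulr_ge0.
- by move=> x _ m n mn; rewrite lee_fin ler_wpM2r// ndf.
Qed.

End density_pushforward.

(** * Borel sets, null sets and the completed Lebesgue measure *)

Section completed_lebesgue.
Local Open Scope ereal_scope.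
Context {R : realType}.

Notation mu := (@lebesgue_measure R).
Notation cmu := (@completed_lebesgue_measure R).
Notation CR := (caratheodory_type (wlength (@idfun R))^*%mu).

Lemma measurable_completed (A : set R) :
  measurable (A : set (measurableTypeR R)) -> measurable (A : set CR).
Proof. exact: sub_caratheodory. Qed.

Lemma measurable_fun_completed d (T : measurableType d) (D : set R) (f : R -> T) :
  measurable (D : set (measurableTypeR R)) ->
  measurable_fun (D : set (measurableTypeR R)) f ->
  measurable_fun (D : set CR) f.
Proof. by move=> mD mf _ B mB; apply: measurable_completed; exact: mf. Qed.

(** The identity is measurable from the completed space to the Borel space, and it pushes [cmu]
    forward to [mu]. *)
Lemma ge0_integral_completed (D : set R) (f : R -> \bar R) :
  measurable D -> measurable_fun D f -> (forall x, D x -> 0 <= f x) ->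
  \int[cmu]_(x in D) f x = \int[mu]_(x in D) f x.
Proof.
move=> mD mf f0.
have mid : measurable_fun [set: CR] (idfun : CR -> measurableTypeR R).
  by apply: measurable_fun_completed; [exact: measurableT|exact: measurable_id].
rewrite -[LHS](@ge0_integral_pushforward _ _ CR (measurableTypeR R) _ _ mid)//.
by move=> x /set_mem; exact: f0.
Qed.

Lemma negligible_completed (N : set R) :
  mu.-negligible N -> cmu.-negligible N.
Proof.
by move=> [B [mB B0 NB]]; exists B; split => //; exact: measurable_completed.
Qed.

Lemma measurable_negligible_completed (N : set R) :
  mu.-negligible N -> measurable (N : set CR).
Proof.
by move=> /negligible_completed; exact: completed_lebesgue_measure_is_complete.
Qed.

(** The Caratheodory sigma-algebra is the completion of the Borel one, whose members are Borel sets
    enlarged by a null set. *)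
Lemma measurable_completedP (A : set R) : measurable (A : set CR) ->
  exists X N : set R, [/\ measurable X, mu.-negligible N & A = X `|` N].
Proof.
move=> mA; have : completed_algebra_gen mu A.
  by rewrite -g_sigma_completed_algebra_genE completed_caratheodory_measurable.
by move=> [X mX [N N0 <-]]; exists X, N.
Qed.

End completed_lebesgue.

(** * Substitution along an increasing bijection with positive density *)

Section change_of_variables.
Local Open Scope ereal_scope.
Context {R : realType}.
Variables F G h : R -> R.
Hypotheses (FK : cancel F G) (GK : cancel G F).
Hypothesis F_mono : {mono F : x y / (x <= y)%R}.
Hypothesis mh : measurable_fun setT h.
Hypothesis h_gt0 : forall x, (0 < h x)%R.

Notation mu := (@lebesgue_measure R).
Notation cmu := (@completed_lebesgue_measure R).
Notation CR := (caratheodory_type (wlength (@idfun R))^*%mu).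

Hypothesis FE : forall x y, (x < y)%R ->
  \int[mu]_(t in `]x, y]) (h t)%:E = (F y - F x)%:E.

Let h_ge0 x : (0 <= h x)%R. Proof. exact: ltW. Qed.

Let F_lt : {mono F : x y / (x < y)%R}. Proof. exact: leW_mono. Qed.

Let G_mono : {mono G : x y / (x <= y)%R}.
Proof. by move=> x y; rewrite -F_mono !GK. Qed.

Let G_lt : {mono G : x y / (x < y)%R}. Proof. exact: leW_mono. Qed.

Let mF : measurable_fun [set: R] F.
Proof. by apply: nondecreasing_measurable => // x y; rewrite F_mono. Qed.

Let mG : measurable_fun [set: R] G.
Proof. by apply: nondecreasing_measurable => // x y; rewrite G_mono. Qed.

Let mpreF (A : set R) : measurable A -> measurable (F @^-1` A).
Proof. by move=> mA; rewrite -(setTI (_ @^-1` _)); exact: mF. Qed.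

Let mpreG (A : set R) : measurable A -> measurable (G @^-1` A).
Proof. by move=> mA; rewrite -(setTI (_ @^-1` _)); exact: mG. Qed.

(** The right-hand side is a measure in [A] that agrees with [mu] on half-open intervals by [FE];
    uniqueness of the Lebesgue measure does the rest. *)
Lemma lebesgue_measure_preimage (A : set R) : measurable A ->
  mu A = \int[mu]_(x in F @^-1` A) (h x)%:E.
Proof.
pose nu (A : set (measurableTypeR R)) := \int[mu]_(x in F @^-1` A) (h x)%:E.
have nu0 : nu set0 = 0 by rewrite /nu preimage_set0 integral_set0.
have nu_ge0 B : 0 <= nu B by apply: integral_ge0 => x _; rewrite lee_fin.
have nuU : semi_sigma_additive nu.
  move=> B mB tB mUB.
  rewrite [X in _ --> X](_ : _ = \sum_(0 <= i <oo) nu (B i)).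
    by apply: is_cvg_ereal_nneg_natsum => n _; exact: nu_ge0.
  rewrite /nu preimage_bigcup ge0_integral_bigcup//.
  - by move=> k; exact: (mpreF (mB k)).
  - exact/measurable_EFinP/measurable_funTS.
  - by move=> x _; rewrite lee_fin.
  - apply/trivIsetP => i j _ _ ij; rewrite -preimage_setI.
    by move/trivIsetP : tB => ->; rewrite ?preimage_set0.
pose M : {measure set (measurableTypeR R) -> \bar R} :=
  HB.pack nu (isMeasure.Build _ _ _ nu nu0 nu_ge0 nuU).
apply: (@lebesgue_measure_unique _ M) => _ [[x y]] _ <- /=.
rewrite /nu lebesgue_measure_itv/= lte_fin; case: ifPn => [xy|].
  rewrite (_ : _ @^-1` _ = `]G x, G y]%classic).
    by rewrite FE ?G_lt// !GK.
  by apply/seteqP; split => z /=; rewrite !in_itv/= -(F_lt (G x)) -(F_mono z) !GK.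
by rewrite -leNgt => yx; rewrite set_itv_ge ?bnd_simp -?leNgt//;
   rewrite preimage_set0 integral_set0.
Qed.

Lemma negligible_preimage (N : set R) :
  mu.-negligible N -> mu.-negligible (F @^-1` N).
Proof.
move=> [B [mB B0 NB]].
have mhB : measurable_fun (F @^-1` B) (EFin \o h).
  exact/measurable_EFinP/measurable_funTS.
have /(ae_eq_integral_abs mu (mpreF mB) mhB) h0 :
    \int[mu]_(x in F @^-1` B) `|(EFin \o h) x| = 0.
  rewrite -[RHS]B0 lebesgue_measure_preimage//.
  by apply: eq_integral => x _; rewrite /= ger0_norm.
apply: negligibleS h0 => x /= /NB BFx /(_ BFx) [] /eqP.
by rewrite gt_eqF.
Qed.

Lemma negligible_preimageV (N : set R) :
  mu.-negligible N -> mu.-negligible (G @^-1` N).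
Proof.
move=> [B [mB B0 NB]]; exists (G @^-1` B); split => //.
- exact: mpreG.
- rewrite lebesgue_measure_preimage; last exact: mpreG.
  rewrite (_ : F @^-1` _ = B); last by apply/funext => x /=; rewrite FK.
  rewrite -[RHS](@integral_abs_eq0 _ _ _ mu B (EFin \o h))//.
    by apply: eq_integral => x _; rewrite /= ger0_norm.
  exact/measurable_EFinP/measurable_funTS.
- exact: preimage_subset.
Qed.

(** Borel measurability of [F] handles the Borel part of a Lebesgue set; its null part needs
    [negligible_preimage]. *)
Lemma measurable_fun_completedF : measurable_fun [set: CR] (F : CR -> CR).
Proof.
move=> _ _ /measurable_completedP[X [N [mX N0 ->]]]; rewrite setTI preimage_setU.
apply: measurableU; first exact: measurable_completed (mpreF mX).
exact: measurable_negligible_completed (negligible_preimage N0).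
Qed.

Lemma measurable_fun_completedG : measurable_fun [set: CR] (G : CR -> CR).
Proof.
move=> _ _ /measurable_completedP[X [N [mX N0 ->]]]; rewrite setTI preimage_setU.
apply: measurableU; first exact: measurable_completed (mpreG mX).
exact: measurable_negligible_completed (negligible_preimageV N0).
Qed.

Let cmh : measurable_fun [set: CR] h.
Proof. by apply: measurable_fun_completed => //; exact: measurableT. Qed.

Let cmpreF (A : set R) : measurable (A : set CR) -> measurable (F @^-1` A : set CR).
Proof.
by move=> mA; rewrite -(setTI (_ @^-1` _)); exact: measurable_fun_completedF.
Qed.

(* Removing from A a Borel null set leaves a Borel set. *)
Lemma completed_lebesgue_measure_preimage (A : set R) :
  measurable (A : set CR) -> cmu A = \int[cmu]_(x in F @^-1` A) (h x)%:E.
Proof.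
move=> mA; have [X [N [mX [B [mB B0 NB]] AE]]] := measurable_completedP mA.
have XB : A `\` B = X `\` B.
  rewrite AE setDUl (_ : N `\` B = set0) ?setU0//.
  by apply/seteqP; split => x // [/NB].
have mXB : measurable (X `\` B) by exact: measurableD.
have cmB : measurable (B : set CR) by exact: measurable_completed.
have FB0 : cmu (F @^-1` B) = 0.
  have nF : mu.-negligible (F @^-1` B) by apply: negligible_preimage; exists B; split => // x.
  exact: (measure_negligible (measurable_completed (mpreF mB)) (negligible_completed nF)).
have AB0 : cmu (A `&` B) = 0.
  apply: (measure_negligible (measurableI _ _ mA cmB)).
  by exists B; split => //; exact: subIsetr.
have -> : cmu A = cmu (A `\` B).
  rewrite -[RHS]adde0; apply: etrans (measureDI cmu mA cmB) _.
  by congr (_ + _); exact: AB0.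
have mhA : measurable_fun (F @^-1` A : set CR) (fun x => (h x)%:E).
  exact/measurable_EFinP/measurable_funTS.
have hA0 x : (F @^-1` A) x -> 0 <= (h x)%:E by rewrite lee_fin.
rewrite (ge0_negligible_integral (cmpreF cmB) (cmpreF mA) mhA hA0 FB0).
rewrite (_ : F @^-1` A `\` _ = F @^-1` (X `\` B)); last by rewrite -XB.
rewrite XB ge0_integral_completed.
- exact: lebesgue_measure_preimage.
- exact: mpreF.
- exact/measurable_EFinP/measurable_funTS.
- by move=> x _; rewrite lee_fin.
Qed.

Lemma ge0_integral_change_of_variables (D : set R) (f : R -> \bar R) :
  measurable (D : set CR) -> measurable_fun (D : set CR) f ->
  (forall y, D y -> 0 <= f y) ->
  \int[cmu]_(y in D) f y = \int[cmu]_(x in F @^-1` D) (f (F x) * (h x)%:E).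
Proof.
exact: (ge0_integral_density_pushforward measurable_fun_completedF cmh h_ge0
  completed_lebesgue_measure_preimage).
Qed.

Lemma measurable_fun_change_of_variables (D : set R) (g : R -> R) :
  measurable (D : set CR) ->
  measurable_fun (F @^-1` D : set CR) (fun x => g (F x) * h x)%R <->
  measurable_fun (D : set CR) g.
Proof.
move=> mD; split=> mg.
  have hG_neq0 y : h (G y) != 0%R by rewrite gt_eqF.
  have mhG : measurable_fun [set: CR] (h \o G).
    exact: measurableT_comp cmh measurable_fun_completedG.
  (* The reciprocal is written as a power with exponent -1, so that [measurable_powR] applies. *)
  have gE : g = (fun y => (g (F (G y)) * h (G y)) * h (G y) `^ (-1))%R.
    by apply/funext => y; rewrite powR_inv1// GK mulfK.
  rewrite gE.
  apply: measurable_funM.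
    apply: (@measurable_comp _ _ _ CR CR _ (F @^-1` D)
      (fun x => g (F x) * h x)%R) => //.
    - exact: cmpreF.
    - by move=> _ [y Dy <-] /=; rewrite GK.
    - exact: measurable_funTS measurable_fun_completedG.
  apply: measurable_funTS.
  pose p : R -> R := @powR R ^~ (-1)%R.
  have mp : measurable_fun setT p by exact: measurable_powR.
  exact: (measurableT_comp mp mhG).
apply: measurable_funM; last exact: measurable_funTS.
apply: (@measurable_comp _ _ _ CR CR _ D g) => //.
- by move=> _ [x Dx <-].
- exact: measurable_funTS measurable_fun_completedF.
Qed.

Lemma integrable_change_of_variables (D : set R) (g : R -> R) :
  measurable (D : set CR) ->
  cmu.-integrable (F @^-1` D) (EFin \o (fun x => g (F x) * h x)%R) <->
  cmu.-integrable D (EFin \o g).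
Proof.
move=> mD.
have intE : measurable_fun (D : set CR) g -> \int[cmu]_(y in D) `|(g y)%:E| =
    \int[cmu]_(x in F @^-1` D) `|(g (F x) * h x)%:E|.
  move=> mg; have mag : measurable_fun (D : set CR) (fun y => `|(g y)%:E|).
    by apply: measurableT_comp; [exact: abse_measurable|exact/measurable_EFinP].
  rewrite (ge0_integral_change_of_variables mD mag); last by move=> y _.
  by apply: eq_integral => x _; rewrite EFinM abseM (@gee0_abs _ (h x)%:E) ?lee_fin.
split=> /integrableP[/measurable_EFinP mg goo]; apply/integrableP.
  move: mg => /measurable_fun_change_of_variables -/(_ mD) mg.
  split; first exact/measurable_EFinP.
  by rewrite /comp intE.
split; last by rewrite /comp -intE.
exact/measurable_EFinP/measurable_fun_change_of_variables.
Qed.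

(** Multiplication by [h >= 0] commutes with taking positive and negative parts, which reduces to
    the nonnegative case. *)
Lemma integral_change_of_variables (D : set R) (g : R -> R) :
  measurable (D : set CR) -> measurable_fun (D : set CR) g ->
  \int[cmu]_(y in D) (g y)%:E = \int[cmu]_(x in F @^-1` D) (g (F x) * h x)%:E.
Proof.
move=> mD /measurable_EFinP mg; rewrite integralE [RHS]integralE.
have hh x : 0 <= (h x)%:E by rewrite lee_fin.
congr (_ - _).
  rewrite ge0_integral_change_of_variables//; last exact: measurable_funepos.
  apply: eq_integral => x _.
  by rewrite !funeposE EFinM maxe_pMl// mul0e.
rewrite ge0_integral_change_of_variables//; last exact: measurable_funeneg.
apply: eq_integral => x _.
by rewrite !funenegE EFinM -mulNe maxe_pMl// mul0e.
Qed.

Let preimage_itvcc a b : F @^-1` `[F a, F b] = `[a, b]%classic.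
Proof. by apply/seteqP; split => x /=; rewrite !in_itv/= !F_mono. Qed.

Let measurable_itvcc (a b : R) : measurable (`[a, b]%classic : set CR).
Proof. exact: (measurable_completed (measurable_itv `[a, b])). Qed.

(* Equal filters: existence and value of limits transfer in both directions. *)
Lemma cvg_pinfty_increasing_bijection : F x @[x --> +oo%R] = +oo%R.
Proof.
apply/seteqP; split => A [M [Mreal MA]].
  exists (F M); split; first exact: num_real.
  by move=> y My; rewrite -(GK y); apply: MA; rewrite -F_lt GK.
exists (G M); split; first exact: num_real.
by move=> x Mx; apply: MA; rewrite -(GK M) F_lt.
Qed.

(** * Substitution in complex improper integrals *)

Section improper.
Variables (a : R) (u v : R -> Cplx R).
Hypothesis vE : forall x, (a <= x)%R -> v x = (u (F x) * (h x)%:C%C)%R.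

Let ReE x : (a <= x)%R -> complex.Re (v x) = (complex.Re (u (F x)) * h x)%R.
Proof.
by move=> /vE ->; case: (u (F x)) => p q /=; rewrite mulr0 subr0.
Qed.

Let ImE x : (a <= x)%R -> complex.Im (v x) = (complex.Im (u (F x)) * h x)%R.
Proof.
by move=> /vE ->; case: (u (F x)) => p q /=; rewrite mulr0 add0r.
Qed.

Lemma cintegrable_change_of_variables b :
  cintegrable `[a, b] v <-> cintegrable `[F a, F b] u.
Proof.
have eqi (p q : R -> R) : (forall x, (a <= x)%R -> p x = q x) ->
    cmu.-integrable `[a, b] (EFin \o p) <-> cmu.-integrable `[a, b] (EFin \o q).
  by move=> pq; split; apply: eq_integrable => // x;
     rewrite inE/= in_itv/= => /andP[ax _]; rewrite /= pq.
rewrite /cintegrable (eqi _ _ ReE) (eqi _ _ ImE) -preimage_itvcc.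
have mD := measurable_itvcc (F a) (F b).
have ire := integrable_change_of_variables (fun x => complex.Re (u x)) mD.
have iim := integrable_change_of_variables (fun x => complex.Im (u x)) mD.
by split=> -[/ire ? /iim].
Qed.

Lemma cintegral_change_of_variables b : cintegrable `[F a, F b] u ->
  cintegral `[a, b] v = cintegral `[F a, F b] u.
Proof.
move=> [/integrableP[/measurable_EFinP mre _] /integrableP[/measurable_EFinP mim _]].
have eqi (p q : R -> R) : (forall x, (a <= x)%R -> p x = (q (F x) * h x)%R) ->
    measurable_fun (`[F a, F b]%classic : set CR) q ->
    (\int[cmu]_(x in `[a, b]) p x = \int[cmu]_(y in `[F a, F b]) q y)%R.
  move=> pq mq; rewrite /Rintegral [in RHS]integral_change_of_variables// preimage_itvcc.
  congr fine; apply: eq_integral => x.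
  by rewrite inE/= in_itv/= => /andP[ax _]; rewrite pq.
by rewrite /cintegral (eqi _ _ ReE mre) (eqi _ _ ImE mim).
Qed.

(** The two convergence conditions are equivalent, so both sides are [None] together, and otherwise
    the two limits coincide. *)
Lemma improper_integral_change_of_variables :
  improper_integral a v = improper_integral (F a) u.
Proof.
(* The limits are compared only under the condition, since their equality rests on integrability
   over the bounded intervals. *)
have ifE (b b' : bool) (l l' : Cplx R) : b = b' -> (b' -> l = l') ->
    (if b then Some l else None) = (if b' then Some l' else None).
  by move=> ->; case: b' => // ->.
have intE : (forall b, (a <= b)%R -> cintegrable `[a, b] v) <->
            (forall c, (F a <= c)%R -> cintegrable `[F a, c] u).
  split=> iv c ac; last by apply/cintegrable_change_of_variables/iv; rewrite F_mono.
  by rewrite -(GK c); apply/cintegrable_change_of_variables/iv; rewrite -F_mono GK.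
have limE : (forall c, (F a <= c)%R -> cintegrable `[F a, c] u) ->
    cintegral `[a, b] v @[b --> +oo%R] = cintegral `[F a, c] u @[c --> +oo%R].
  (* Taking [c = F b] expresses both limits along [b]; the integrals then agree as soon as
     [a <= b]. *)
  move=> iu; rewrite -[in RHS]cvg_pinfty_increasing_bijection.
  have vu : {near +oo%R, (fun b => cintegral `[a, b] v) =1
                         (fun b => cintegral `[F a, F b] u)}.
    near=> b; apply/cintegral_change_of_variables/iu.
    by rewrite F_mono; near: b; apply: nbhs_pinfty_ge; exact: num_real.
  by apply/seteqP; split=> A; apply: filterS2 vu => b /= ->.
have convE : integral_converges a v <-> integral_converges (F a) u.
  split=> -[iv]; first by move/intE : (iv) => iu; rewrite limE.
  by move/intE : (iv) => iu; rewrite -limE.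
have cE : `[< integral_converges a v >] = `[< integral_converges (F a) u >].
  exact: asbool_equiv_eq.
rewrite /improper_integral; apply: (ifE _ _ _ _ cE) => /asboolP[iu _].
by congr (lim _); exact: limE.
Unshelve. all: by end_near. Qed.

End improper.

End change_of_variables.

(** * Slopes, and the extension of [phi - phi a] to the whole line *)

(** The substitution [y = t + x] turns the slope at [y] into the difference quotient at [t] that
    defines the derivative. *)
Lemma is_derive_slope (R : realType) (f : R -> R) (x l : R) :
  (f y - f x) / (y - x) @[y --> x^'] --> l -> is_derive x 1 f l.
Proof.
move=> /cvgrPdist_le fl.
have fl0 : (fun t => t^-1 *: ((f \o shift x) (t *: 1) - f x)) @ 0^' --> l.
  apply/cvgrPdist_le => e /fl; rewrite !near_withinE => /nbhs_ballP[d /= d0 dfl].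
  apply/nbhs_ballP; exists d => //= t; rewrite /ball/= sub0r normrN => td t0.
  have := dfl (t + x); rewrite /ball/= opprD addrCA subrr addr0 normrN addrK.
  rewrite -subr_eq0 addrK [t%:A]mulr1 mulrC; exact.
apply: DeriveDef; first by apply/cvg_ex; exists l.
exact: cvg_lim fl0.
Qed.

Section affine_extension.
Context {R : realType}.
Variables (a : R) (phi : R -> R).
Hypothesis phi_incr : {in `[a, +oo[ &, {homo phi : x y / x < y}}.
Hypothesis phi_C1 : C1_on `[a, +oo[ phi.
Hypothesis phi_pos : forall x, a <= x -> 0 < derive_on `[a, +oo[ phi x.
Hypothesis phi_infty : phi x @[x --> +oo] --> +oo.

(* Continuing [phi - phi a] on the left of [a] by its tangent gives a C^1
   bijection of the whole line, which avoids one-sided derivatives at [a]. *)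
Definition affine_extension (x : R) : R :=
  if a <= x then phi x - phi a else derive_on `[a, +oo[ phi a * (x - a).

(** Clamping the argument at [a] gives the constant slope of the tangent on the left of [a]. *)
Definition affine_extension_derivative (x : R) : R :=
  derive_on `[a, +oo[ phi (Num.max a x).

Notation F := affine_extension.
Notation h := affine_extension_derivative.

Lemma affine_extension_ge x : a <= x -> F x = phi x - phi a.
Proof. by rewrite /F => ->. Qed.

Lemma affine_extension_le x : x <= a -> F x = h a * (x - a).
Proof.
rewrite /F /h maxxx; case: ifPn => // ax xa.
have -> : x = a by apply/eqP; rewrite eq_le xa ax.
by rewrite !subrr mulr0.
Qed.

Lemma affine_extension_derivative_ge x : a <= x -> h x = derive_on `[a, +oo[ phi x.
Proof. by move=> ax; rewrite /h max_r. Qed.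

Lemma affine_extension_derivative_gt0 x : 0 < h x.
Proof. by rewrite /h phi_pos// le_max lexx. Qed.

Lemma affine_extension_slope x : (F y - F x) / (y - x) @[y --> x^'] --> h x.
Proof.
have slope_lt z y : z <= a -> y <= a -> y != z -> (F y - F z) / (y - z) = h a.
  move=> za ya yz; rewrite !affine_extension_le// -mulrBr opprB addrA subrK mulfK//.
  by rewrite subr_eq0.
apply/cvgrPdist_le => e e0; have [ax|xa] := leP a x; last first.
  near=> y; rewrite slope_lt.
  - by rewrite /h maxxx (max_l (ltW xa)) subrr normr0 ltW.
  - exact: ltW.
  - by apply/ltW; near: y; apply: nbhs_dnbhs; exact: lt_nbhsl.
  - by near: y; exact: nbhs_dnbhs_neq.
have phix : slope_on `[a, +oo[ phi x --> h x.
  by rewrite affine_extension_derivative_ge//; apply: phi_C1.1; rewrite /= in_itv/= ax.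
move/cvgrPdist_le : phix => /(_ e e0); rewrite near_withinE => phix.
have lta : a < x -> \forall y \near x^', a < y.
  by move=> ltax; apply: nbhs_dnbhs; exact: lt_nbhsr.
(* At [a] itself, right-hand slopes are those of [phi] within its domain and left-hand slopes equal
   [h a] exactly. Beyond [a], all nearby points lie in the domain. *)
move: ax; rewrite le_eqVlt => /predU1P[ax|ltax].
  subst x; near=> y; have [ay|ya] := leP a y.
    rewrite !affine_extension_ge// opprB addrA subrK.
    have := near phix y; rewrite /= in_itv/= andbT; exact.
  rewrite slope_lt ?lexx ?(ltW ya) ?lt_eqF//.
  by rewrite subrr normr0 ltW.
near=> y; have ay : a < y by near: y; exact: lta.
rewrite !affine_extension_ge ?(ltW ay) ?(ltW ltax)// opprB addrA subrK.
have := near phix y; rewrite /= in_itv/= andbT (ltW ay); exact.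
Unshelve. all: by end_near. Qed.

Lemma affine_extension_is_derive (x : R) : is_derive x 1 F (h x).
Proof. exact/is_derive_slope/affine_extension_slope. Qed.

Lemma affine_extension_continuous : continuous F.
Proof.
move=> x; apply/differentiable_continuous/derivable1_diffP.
by case: (affine_extension_is_derive x).
Qed.

(** The clamp [Num.max a x] is continuous with values in the domain, so continuity of the derivative
    within the domain is enough. *)
Lemma affine_extension_derivative_continuous : continuous h.
Proof.
have cmax : continuous (fun x : R => Num.max a x).
  by move=> x; apply: continuous_max => //; exact: cvg_cst.
move=> x; have /subspace_continuousP cD := phi_C1.2.
have aM z : `[a, +oo[%classic (Num.max a z) by rewrite /= in_itv/= le_max lexx.
move=> A /(cD _ (aM x)) nA.
have nx : \forall z \near x, `[a, +oo[%classic (Num.max a z) -> A (h z).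
  exact: cmax nA.
by apply: filterS nx => z; apply.
Qed.

Lemma affine_extension_lt_homo : {homo F : x y / x < y}.
Proof.
move=> x y xy; have [ax|xa] := leP a x.
  have ay : a <= y by apply: le_trans ax (ltW xy).
  by rewrite !affine_extension_ge// ltrD2r phi_incr// ?in_itv/= ?ax ?ay.
rewrite (affine_extension_le (ltW xa)); have [ay|ya] := leP a y.
  (* For [x < a <= y], zero separates the branches: the tangent is negative left of [a], and
     [phi - phi a] is nonnegative from [a] on. *)
  apply: (@lt_le_trans _ _ 0); first by rewrite pmulr_rlt0 ?affine_extension_derivative_gt0// subr_lt0.
  rewrite affine_extension_ge// subr_ge0.
  move: ay; rewrite le_eqVlt => /predU1P[<-//|ay].
  by rewrite ltW// phi_incr// in_itv/= ?lexx ?ltW.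
rewrite affine_extension_le ?ltW// ltr_pM2l ?affine_extension_derivative_gt0//.
by rewrite ltrD2r.
Qed.

Lemma affine_extension_mono : {mono F : x y / x <= y}.
Proof. exact: le_mono affine_extension_lt_homo. Qed.

Lemma affine_extension_surjective y : exists x, F x = y.
Proof.
have Fa : F a = 0 by rewrite affine_extension_ge// subrr.
have [y0|y0] := leP 0 y; last first.
  (* Negative values are taken on the tangent: this point solves [h a * (x - a) = y]. *)
  exists (a + y / h a); rewrite affine_extension_le.
    by rewrite addrAC subrr add0r mulrC divfK// gt_eqF// affine_extension_derivative_gt0.
  by rewrite gerDl ltW// pmulr_llt0// invr_gt0 affine_extension_derivative_gt0.
(* Since [phi] tends to infinity, some [b] satisfies [y <= F b], and the intermediate value theorem
   applies on [[a, b]]. *)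
have [b [ab yb]] : exists b, a <= b /\ y + phi a <= phi b.
  have /cvgryPge/(_ (y + phi a)) := phi_infty => phiy.
  near (pinfty_nbhs R) => b; exists b; split; first by near: b;
    apply: nbhs_pinfty_ge; exact: num_real.
  by near: b.
have Fb : y <= F b by rewrite affine_extension_ge// lerBrDr.
have [] := @IVT R F a b y ab.
- exact/continuous_subspaceT/affine_extension_continuous.
- by rewrite Fa min_l ?max_r ?y0//; apply: le_trans y0 Fb.
by move=> x _ <-; exists x.
Unshelve. all: by end_near. Qed.

Lemma integral_affine_extension_derivative x y : x < y ->
  (\int[@lebesgue_measure R]_(t in `]x, y]) (h t)%:E = (F y - F x)%:E)%E.
Proof.
move=> xy; have ch := affine_extension_derivative_continuous.
(* Adding the left endpoint leaves the integral unchanged and gives the closed interval of the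
   fundamental theorem of calculus. *)
rewrite integral_itv_obnd_cbnd; last first.
  have mh : measurable_fun [set: R] h by exact: continuous_measurable_fun.
  by apply/measurable_EFinP; exact: measurable_funTS.
rewrite EFinB; apply: continuous_FTC2 => //.
- exact: continuous_subspaceT.
- split.
  + by move=> z _; case: (affine_extension_is_derive z).
  + exact/cvg_at_right_filter/affine_extension_continuous.
  + exact/cvg_at_left_filter/affine_extension_continuous.
- by move=> z _; rewrite derive1E; apply: derive_val; exact: affine_extension_is_derive.
Qed.

End affine_extension.

Theorem theorem4p2 (R : realType) (a : R) (phi : R -> R) (w : R -> Cplx R)
  (phi_incr : {in `[a, +oo[ &, {homo phi : x y / x < y}})
  (phi_C1 : C1_on `[a, +oo[ phi)
  (phi_pos : forall x, a <= x -> 0 < derive_on `[a, +oo[ phi x)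
  (phi_infty : phi x @[x --> +oo] --> +oo) :
  weighted_laplace a phi w =
    @laplace R \o Qinv `[a, +oo[ (fun x => phi x - phi a) \o mul_op w.
Proof.
have mono := affine_extension_mono phi_incr phi_pos.
have [G GK] := choice (affine_extension_surjective phi_C1 phi_pos phi_infty).
have FK : cancel (affine_extension a phi) G.
  by move=> x; apply: (inc_inj mono); rewrite GK.
have mh : measurable_fun setT (affine_extension_derivative a phi).
  apply: continuous_measurable_fun.
  exact: affine_extension_derivative_continuous phi_C1.
have hF := integral_affine_extension_derivative phi_C1.
have Fa : affine_extension a phi a = 0 by rewrite affine_extension_ge ?subrr.
pose psi x := phi x - phi a.
have psi_inj : {in `[a, +oo[%classic &, injective psi}.
  move=> x y; rewrite !inE => ax ay /addIr.
  exact: (inc_inj_in (le_mono_in phi_incr) ax ay).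
(* The partial inverse in [Qinv] undoes [psi] on [[a, +oo[], where [psi] agrees with the extension;
   this is all that the integrands see. *)
have psiK x : a <= x -> pinv `[a, +oo[ psi (phi x - phi a) = x.
  by move=> ax; apply: (pinvKV _ psi_inj); rewrite inE/= in_itv/= ax.
apply/funext => f; apply/funext => s.
(* Writing the lower bound 0 as the value of the extension at [a] puts the usual transform in
   substituted form; it remains to match the integrands pointwise for [a <= x]. *)
rewrite /laplace/= -Fa; apply: (improper_integral_change_of_variables FK GK mono
  mh (affine_extension_derivative_gt0 phi_pos) hF) => x ax.
rewrite affine_extension_ge// affine_extension_derivative_ge// /Qinv /mul_op/=.
by rewrite psiK// !mulrA.
Qed.
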